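(* There is an absolute constant $C$ such that for all sufficiently large $n$ the following holds: for every graph $G$ with at most $\left(2+\frac{43}{651}\right)n-C$ edges there is a red/blue coloring of $E(G)$ in which the red graph is acyclic and the blue graph contains no path on $n$ vertices. In particular $\hat{R}(\mathcal{C},P_n)\ge \left(2+\frac{43}{651}\right)n-O(1)>2.066n$ for sufficiently large $n$.
   Context: $\hat{R}(\mathcal{C},P_n)$ is the minimum number of edges of a graph $G$ such that every red/blue coloring of $E(G)$ contains a red cycle or a blue path on $n$ vertices. $P_n$ is the path on $n$ vertices. *)

(* Defs.v *)
From mathcomp Require Import all_boot all_order all_algebra.
Set Implicit Arguments. Unset Strict Implicit. Unset Printing Implicit Defensive.

Definition simple_graph (T : finType) (e : rel T) : Prop :=
  symmetric e /\ irreflexive e.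

Definition edge_set (T : finType) (e : rel T) : {set {set T}} :=
  [set A : {set T} | [exists u, exists v, e u v && (A == [set u; v])]].

Definition num_edges (T : finType) (e : rel T) : nat := #|edge_set e|.

Definition is_cycle (T : finType) (r : rel T) (c : seq T) : bool :=
  [&& 3 <= size c, uniq c & cycle r c].

Definition acyclic (T : finType) (r : rel T) : Prop :=
  forall c : seq T, ~~ is_cycle r c.

Definition is_path_on (T : finType) (r : rel T) (k : nat) (p : seq T) : bool :=
  [&& size p == k, uniq p &
      match p with [::] => true | x :: q => path r x q end].

Definition contains_path (T : finType) (r : rel T) (k : nat) : Prop :=
  exists p : seq T, is_path_on r k p.

(* A red/blue coloring of E(G) is given by the red edge relation: a symmetric
   subrelation of e; the blue edges are the remaining edges of G. *)
Definition red_coloring (T : finType) (e red : rel T) : Prop :=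
  symmetric red /\ (forall x y, red x y -> e x y).

Definition blue_of (T : finType) (e red : rel T) : rel T :=
  fun x y => e x y && ~~ red x y.

(* Main.v *)
(** Choose a maximal family of vertex-disjoint stars whose centers have degree 3
or 4 and have at most one neighbor outside their star, and let the red graph be
a spanning forest containing all the stars. Let [K] be the component of a blue
path on [n] vertices, [k] its order, [D] its degree sum, and let [s], [z], [y]
be the numbers of vertices of [K] that are star centers, have degree at most 2,
or have blue degree at least 2. The interior of the path gives [n <= y + 2].
Centers and vertices of degree at most 2 have blue degree at most 1, hence
[s + z + y <= k]; counting red and blue degrees separately gives
[2 (k - 1) + 2 y <= D]. By maximality an uncovered vertex of degree 3 or 4 has
at least two covered neighbors, and counting the edges leaving the stars yields
[5 k <= D + 17 s + 4 z]. Eliminating [s], [z] and [k] gives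
[58 y <= 14 D + 24], where [D] is at most twice the number of edges, and
[29 / 14 > 2 + 43 / 651]. *)

Require Import Defs.
From mathcomp Require Import all_boot all_order all_algebra.
From mathcomp Require Import zify lra.
Import GRing.Theory Num.Theory.

Set Implicit Arguments. Unset Strict Implicit. Unset Printing Implicit Defensive.

(** * Degree sums, connected components and paths *)

Section Degrees.
Variable T : finType.
Implicit Types (r : rel T) (x y : T) (A K : {set T}).

Definition deg r x := #|[set y | r x y]|.

Definition arcs r A := [set p : T * T | [&& p.1 \in A, p.2 \in A & r p.1 p.2]].

Lemma card_arcs_le r A : #|arcs r A| <= \sum_(x in A) deg r x.
Proof.
have -> : \sum_(x in A) deg r x = #|[set p : T * T | (p.1 \in A) && r p.1 p.2]|.
  rewrite -sum1_card (eq_bigl (fun p : T * T => (p.1 \in A) && r p.1 p.2)); last first.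
    by move=> p; rewrite inE.
  rewrite -(pair_big_dep (fun x => x \in A) (fun x y => r x y) (fun _ _ => 1)) /=.
  apply: eq_bigr => x _; rewrite /deg -sum1_card.
  by apply: eq_bigl => y; rewrite inE.
by apply/subset_leq_card/subsetP=> p; rewrite !inE => /and3P[-> _ ->].
Qed.

(** Adjacent ordered pairs are grouped by their underlying unordered pair; each fibre has at most
    the two elements [(u, v)] and [(v, u)]. *)
Lemma handshake_le (e : rel T) : irreflexive e ->
  \sum_x deg e x <= 2 * num_edges e.
Proof.
move=> irr_e.
have -> : \sum_x deg e x = \sum_(p : T * T | e p.1 p.2) 1.
  rewrite -(pair_big_dep xpredT (fun x y => e x y) (fun _ _ => 1)) /=.
  apply: eq_bigr => x _; rewrite /deg -sum1_card.
  by apply: eq_bigl => y; rewrite inE.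
rewrite (partition_big (fun p : T * T => [set p.1; p.2])
          (fun B => B \in edge_set e)) /=; last first.
  move=> p ep; rewrite inE; apply/existsP; exists p.1; apply/existsP; exists p.2.
  by rewrite ep eqxx.
rewrite /num_edges mulnC -sum_nat_const; apply: leq_sum => B.
rewrite inE => /existsP[u /existsP[v /andP[euv /eqP ->]]].
rewrite sum1_card.
apply: (@leq_trans #|[set (u, v); (v, u)]|); last by rewrite cards2; case: (_ != _).
apply/subset_leq_card/subsetP=> -[a b]; rewrite !inE unfold_in /=.
case/andP=> eab /eqP/setP eqB.
have /esym := eqB a; have /esym := eqB b; have := eqB u; have := eqB v.
rewrite !inE !eqxx !orbT !xpair_eqE /= => Hv Hu Hb Ha.
have neq_ab : a != b by apply: contraTneq eab => ->; rewrite irr_e.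
case/orP: Ha => /eqP Ha; case/orP: Hb => /eqP Hb; subst; rewrite ?eqxx ?orbT //;
  by rewrite eqxx in neq_ab.
Qed.

(** A connected graph on k vertices has at least k - 1 edges: grow a set [A] from [x0] one vertex at
    a time, each new vertex [d] bringing the two new arcs [(a, d)] and [(d, a)]. *)
Lemma deg_sum_connected r K x0 : symmetric r ->
  (forall x, (x \in K) = connect r x0 x) ->
  2 * #|K| <= (\sum_(x in K) deg r x) + 2.
Proof.
move=> sym_r conK.
have grow j : j < #|K| -> exists A, [/\ A \subset K, x0 \in A, #|A| = j.+1 &
    2 * #|A| <= #|arcs r A| + 2].
  elim: j => [|j IHj] ltjK.
    by exists [set x0]; split; rewrite ?sub1set ?conK ?connect0 ?set11 ?cards1 ?leq_addl.
  have [A [AK x0A cA arcA]] := IHj (ltnW ltjK).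
  have [b bK bA] : exists2 b, b \in K & b \notin A.
    apply/subsetPn; apply: contraTN ltjK => KA.
    by rewrite -leqNgt -cA subset_leq_card.
  have [/existsP[a /existsP[d /and3P[aA dA rad]]] | noX] :=
    boolP [exists a, exists d, [&& a \in A, d \notin A & r a d]]; last first.
    (* If no edge leaves [A], it contains the whole component of [x0], contrary to the choice of
       [b]. *)
    have clA : closed r A.
      have half x y : r x y -> x \in A -> y \in A.
        move=> rxy xA; apply: contraNT noX => yA.
        by apply/existsP; exists x; apply/existsP; exists y; rewrite xA yA.
      by move=> x y rxy; apply/idP/idP; apply: half; rewrite // sym_r.
    by move: bK; rewrite conK => /(closed_connect clA); rewrite x0A (negPf bA).
  have dK : d \in K.
    by move: (subsetP AK _ aA); rewrite !conK => /connect_trans-> //; exact: connect1.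
  have neq_ad : a != d by apply: contraNneq dA => <-.
  exists (d |: A); split.
  - by rewrite subUset sub1set dK.
  - by rewrite inE x0A orbT.
  - by rewrite cardsU1 dA cA.
  have sub : [set (a, d); (d, a)] :|: arcs r A \subset arcs r (d |: A).
    apply/subsetP=> -[x y]; rewrite !inE !xpair_eqE /=.
    case/orP=> [/orP[]/andP[/eqP-> /eqP->]|/and3P[-> -> ->]].
    - by rewrite aA eqxx orbT.
    - by rewrite aA eqxx orbT sym_r.
    - by rewrite !orbT.
  have := subset_leq_card sub.
  rewrite cardsU cards2 xpair_eqE (negPf neq_ad) /=.
  have -> : [set (a, d); (d, a)] :&: arcs r A = set0.
    apply/setP=> -[x y]; rewrite !inE !xpair_eqE /=.
    case: (boolP (_ || _)) => //= /orP[]/andP[/eqP-> /eqP->];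
      by rewrite (negPf dA) ?andbF.
  rewrite cards0 subn0 addnC cardsU1 dA /= mulnDr muln1 [2 + _]addnC leq_add2r.
  exact: leq_trans.
have cK : 0 < #|K| by apply/card_gt0P; exists x0; rewrite conK connect0.
have [|A [AK _ cA arcA]] := grow #|K|.-1; first by rewrite prednK.
have eAK : A = K by apply/eqP; rewrite eqEcard AK cA prednK // leqnn.
by move: arcA; rewrite eAK => /leq_trans-> //; rewrite leq_add2r card_arcs_le.
Qed.

(** [behead (belast x q)] is the path without its two ends, so each of its vertices has a
    predecessor and a successor, which are distinct. *)
Lemma path_interior_deg r x q : symmetric r -> uniq (x :: q) -> path r x q ->
  forall y, y \in behead (belast x q) -> 1 < deg r y.
Proof.
move=> sym_r; elim: q x => [//|a q IHq] x.
rewrite [uniq _]/= => /andP[xq uq] /= /andP[rxa pq] y.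
case: q IHq xq uq pq => [//|b q] IHq xq uq pq.
rewrite /= inE => /orP[/eqP->|yq]; last by apply: IHq uq pq _ _.
case/andP: pq => rab _.
have nxb : x != b by apply: contraNneq xq => ->; rewrite !inE eqxx orbT.
apply: (@leq_trans #|[set x; b]|); first by rewrite cards2 nxb.
by apply/subset_leq_card/subsetP=> z; rewrite !inE => /orP[]/eqP-> //; rewrite sym_r.
Qed.

End Degrees.

(** * Extending an acyclic graph to a spanning forest *)

Section Forests.
Variable T : finType.
Implicit Types (r : rel T) (x y u v : T).

Definition add_edge r u v : rel T :=
  fun x y => [|| r x y, (x == u) && (y == v) | (x == v) && (y == u)].

Lemma add_edge_sym r u v : symmetric r -> symmetric (add_edge r u v).
Proof.
move=> sym_r x y; rewrite /add_edge sym_r; congr (_ || _).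
by rewrite orbC [(y == v) && _]andbC [(y == u) && _]andbC.
Qed.

(** A cycle must use the new edge; the rest of the cycle then joins [u] and [v] within [r]. *)
Lemma acyclic_add_edge r u v : symmetric r -> ~~ connect r u v ->
  acyclic r -> acyclic (add_edge r u v).
Proof.
move=> sym_r nuv acr c; apply/negP=> /and3P[sz uc cyc].
have [/allP allr|] := boolP (all (fun x => r x (next c x)) c).
  by case/negP: (acr c); apply/and3P; split=> //; apply: cycle_from_next.
case/allPn=> x xc nrx.
have [i q def_c] := rot_to xc.
have {}nrx : ~~ r x (next (rot i c) x) by rewrite next_rot.
move: sz uc cyc nrx; rewrite -(size_rot i) -(rot_uniq i) -(rot_cycle i) def_c.
case: q {def_c} => [|y [|z q]] //= _.
rewrite !inE !negb_or -!andbA eqxx => /and5P[nxy nxz xq nyz /and3P[yq zq uq]].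
case/and3P=> axy ayz pz nrx.
have euv : (x == u) && (y == v) || (x == v) && (y == u).
  by move: axy; rewrite /add_edge (negPf nrx).
have ryz : r y z.
  move: ayz; case/or3P=> // /andP[/eqP Ey /eqP Ez]; move: euv;
    rewrite -Ey -Ez [y == z](negPf nyz) [x == z](negPf nxz) ?(eq_sym x y) //.
  - by rewrite andbF orbF.
  - by rewrite andbF.
(* The remaining vertices all differ from [y], an end of the new edge, so this stretch uses only
   edges of [r]. *)
have {}pz : path r z (rcons q x).
  apply: (sub_in_path (P := predC1 y)) pz.
    move=> a b /= nay nby /or3P[] // /andP[/eqP Ea /eqP Eb]; move: euv;
      by rewrite -Ea -Eb ![y == _]eq_sym (negPf nay) (negPf nby) !andbF.
  rewrite /= eq_sym nyz all_rcons /= nxy; apply/allP=> b bq /=.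
  by apply: contraNneq yq => <-.
have cyx : connect r y x.
  by apply/connectP; exists (z :: rcons q x); rewrite /= ?ryz ?last_rcons.
have cxy : connect r x y by rewrite (sym_connect_sym sym_r).
by move: nuv; case/orP: euv => /andP[/eqP<- /eqP<-]; rewrite ?cxy ?cyx.
Qed.

(** Induction on the number of [e]-adjacent pairs not yet connected in [r]: adding such a pair as an
    edge keeps [r] acyclic and lowers this number. *)
Lemma spanning_forest (e r : rel T) : symmetric e -> symmetric r ->
  subrel r e -> acyclic r ->
  exists r', [/\ symmetric r', subrel r' e, subrel r r', acyclic r' &
    subrel e (connect r')].
Proof.
move=> sym_e; have [k] := ubnP #|[set p : T * T | e p.1 p.2 & ~~ connect r p.1 p.2]|.
elim: k r => // k IHk r lek sym_r re acr.
have [E|] := eqVneq [set p : T * T | e p.1 p.2 & ~~ connect r p.1 p.2] set0.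
  exists r; split=> // x y exy; have /setP/(_ (x, y)) := E.
  by rewrite !inE exy /= => /negbFE.
case/set0Pn=> -[u v]; rewrite inE /= => /andP[euv nuv].
have sub_r : subrel r (add_edge r u v) by move=> x y rxy; rewrite /add_edge rxy.
have [||||r' [sym_r' r'e rr' acr' er']] := IHk (add_edge r u v).
- rewrite ltnS in lek; apply: leq_trans lek; apply/proper_card/properP; split.
    apply/subsetP=> -[x y]; rewrite !inE /= => /andP[-> /=]; apply: contraNN.
    by apply: connect_sub => a b /sub_r; apply: connect1.
  exists (u, v); rewrite !inE /= ?euv // negbK connect1 //.
  by rewrite /add_edge !eqxx orbT.
- exact: add_edge_sym.
- move=> x y /or3P[/re//||] /andP[/eqP-> /eqP->] //; by rewrite sym_e.
- exact: acyclic_add_edge.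
by exists r'; split=> // x y /sub_r/rr'.
Qed.

Lemma cycle_two_neighbors r c x : symmetric r -> is_cycle r c -> x \in c ->
  exists2 y, (y \in c) && (y != next c x) & r x (next c x) && r x y.
Proof.
move=> sym_r /and3P[sz uc cyc] xc.
have [i q def_c] := rot_to xc.
rewrite -(next_rot i uc).
suff [y yc rxy] : exists2 y, (y \in rot i c) && (y != next (rot i c) x) &
    r x (next (rot i c) x) && r x y by exists y; rewrite // -(mem_rot i).
move: sz uc cyc; rewrite -(size_rot i) -(rot_uniq i) -(rot_cycle i) def_c.
case: q {def_c} => [|y [|z q]] //= _.
rewrite eqxx => /and3P[_ yq _] /and3P[rxy _]; rewrite rcons_path => /andP[_ rlx].
exists (last z q); last by rewrite rxy sym_r.
have lzq := mem_last z q.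
by rewrite !inE -in_cons lzq !orbT; apply: contraNneq yq => <-.
Qed.

End Forests.

(** * Maximal star packings and the count of vertices they give *)

Section Stars.
Variables (T : finType) (e : rel T).
Hypotheses (sym_e : symmetric e) (irr_e : irreflexive e).
Implicit Types (c : {ffun T -> option T}) (K : {set T}).

Lemma card_setI_sum K (P : pred T) : #|[set x in K | P x]| = \sum_(x in K) P x.
Proof.
rewrite -sum1_card big_mkcond [RHS]big_mkcond; apply: eq_bigr => x _.
by rewrite inE; case: (x \in K); case: (P x).
Qed.

Lemma deg_split (P : pred T) x :
  deg e x = #|[set y | e x y & P y]| + #|[set y | e x y & ~~ P y]|.
Proof.
rewrite /deg -(cardsID [set y | P y]); congr (_ + _); apply: eq_card => y;
  by rewrite !inE // andbC.
Qed.

(* [c w = Some s] means that [w] lies in the star with center [s]; centers are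
   the [s] with [c s = Some s]. A center has at most one neighbor outside its
   star. *)
Definition star_packing c := [forall w, forall s, (c w == Some s) ==>
  [&& c s == Some s, (w == s) || e s w, 2 < deg e s < 5 &
      deg e s <= #|[set x | c x == Some s]|]].

Lemma star_packingP c w s : star_packing c -> c w = Some s ->
  [/\ c s = Some s, (w == s) || e s w, 2 < deg e s < 5 &
      deg e s <= #|[set x | c x == Some s]|].
Proof.
move=> /forallP/(_ w)/forallP/(_ s)/implyP pc /eqP/pc.
by case/and4P=> /eqP ? ? ? ?; split.
Qed.

(** Take a packing covering the most vertices. An uncovered [v] of degree 3 or 4 with at most one
    covered neighbor would be the center of a further star, formed with its uncovered neighbors. *)
Lemma maximal_star_packing : exists2 c, star_packing c &
  forall v, ~~ c v -> 2 < deg e v < 5 -> 1 < #|[set w | e v w & c w]|.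
Proof.
have pc0 : star_packing [ffun=> None].
  by apply/forallP=> w; apply/forallP=> s; rewrite ffunE.
case: (arg_maxnP (fun c : {ffun T -> option T} => #|[set w | isSome (c w)]|) pc0).
move=> /= c pc maxc; exists c => // v cv dv; rewrite ltnNge; apply/negP=> few.
pose c' := [ffun w => if (w == v) || (e v w && ~~ c w) then Some v else c w].
have keep w : c w -> c' w = c w.
  move=> cw; rewrite ffunE cw andbF orbF.
  by case: eqP => // Ew; rewrite Ew (negPf cv) in cw.
have cv' : c' v = Some v by rewrite ffunE eqxx.
have /maxc : star_packing c'.
  apply/forallP=> w; apply/forallP=> s; apply/implyP; rewrite {1}ffunE.
  case: ifPn => [Hw /eqP[<-]|_ /eqP cws].
    rewrite cv' eqxx dv /=; apply/andP; split.
      by case/orP: Hw => [->|/andP[-> _]]; rewrite ?orbT.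
    rewrite (deg_split (fun w => c w : bool)).
    apply: (@leq_trans #|v |: [set y | e v y & ~~ c y]|).
      by rewrite cardsU1 inE irr_e leq_add2r.
    apply/subset_leq_card/subsetP=> x; rewrite !inE ffunE => Hx.
    by rewrite Hx eqxx.
  have [cs ws ds cards] := star_packingP pc cws.
  rewrite keep ?cs // eqxx ws ds (leq_trans cards) //.
  apply/subset_leq_card/subsetP=> x; rewrite !inE => /eqP cx.
  by rewrite keep cx.
apply/negP; rewrite -ltnNge; apply/proper_card/properP; split.
  by apply/subsetP=> w; rewrite !inE => cw; rewrite keep.
by exists v; rewrite !inE ?cv'.
Qed.

Definition star_edge c : rel T :=
  fun x y => (x != y) && ((c x == Some y) || (c y == Some x)).

Lemma star_edge_sym c : symmetric (star_edge c).
Proof. by move=> x y; rewrite /star_edge eq_sym orbC. Qed.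

Lemma star_edge_sub c : star_packing c -> subrel (star_edge c) e.
Proof.
move=> pc x y /andP[nxy /orP[]/eqP/(star_packingP pc)[_ + _ _]].
- by rewrite (negPf nxy) sym_e.
- by rewrite eq_sym (negPf nxy).
Qed.

(** A leaf has only its center as neighbor, so every vertex of a cycle is a center; but two centers
    are never joined by a star edge. *)
Lemma star_edge_acyclic c : star_packing c -> acyclic (star_edge c).
Proof.
move=> pc p; apply/negP=> cyc.
have center x : x \in p -> c x = Some x.
  move=> xp; have [y /andP[_ nyn]] := cycle_two_neighbors (@star_edge_sym c) cyc xp.
  case/andP=> /andP[_ /orP[]/eqP Hn] /andP[_ /orP[]/eqP Hy].
  - by move: nyn; rewrite Hn in Hy; case: Hy => ->; rewrite eqxx.
  - by have [] := star_packingP pc Hy.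
  - by have [] := star_packingP pc Hn.
  - by have [] := star_packingP pc Hn.
have /and3P[sz _ cyc'] := cyc.
case: p sz cyc cyc' center => // x p _ _ cyc' center.
have xp : x \in x :: p by rewrite inE eqxx.
have := next_cycle cyc' xp; have := center _ xp.
have := center (next (x :: p) x); rewrite mem_next => /(_ xp) {cyc'}.
move: (next _ x) => y cy cx /andP[nxy].
by rewrite cx cy => /orP[]/eqP[E]; rewrite E eqxx in nxy.
Qed.

(** This bounds the blue degree of a center by 1 once all star edges are red. *)
Lemma star_edge_deg c s : star_packing c -> c s = Some s ->
  deg e s <= (deg (star_edge c) s).+1.
Proof.
move=> pc cs; have [_ _ _ /leq_trans->] // := star_packingP pc cs.
rewrite (cardsD1 s) inE cs eqxx add1n ltnS.
apply/subset_leq_card/subsetP=> x; rewrite !inE /star_edge eq_sym.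
by case/andP=> -> ->; rewrite orbT.
Qed.

(** Discharging: every vertex of [K] must receive 5. An uncovered vertex uses its own degree plus
    one unit from each covered neighbor; a covered vertex [w] gives away [o' w] of its degree in
    this way and keeps [o w]. *)
Lemma star_packing_card c K : star_packing c ->
  (forall v, ~~ c v -> 2 < deg e v < 5 -> 1 < #|[set w | e v w & c w]|) ->
  (forall x y, e x y -> (x \in K) = (y \in K)) ->
  (forall x, x \in K -> 0 < deg e x) ->
  5 * #|K| <= \sum_(x in K) deg e x + 17 * #|[set s in K | c s == Some s]|
              + 4 * #|[set x in K | deg e x <= 2]|.
Proof.
move=> pc maxc clK degK.
pose o v := #|[set w | e v w & c w]|.
pose o' v := #|[set w | e v w & ~~ c w]|.
have degE v : deg e v = o v + o' v by apply: deg_split.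
(* Degree at least 5 suffices alone, degree 3 or 4 is helped by two covered neighbors, and degree 1
   or 2 by the extra 4. *)
have uncovered : \sum_(v in K | ~~ c v) 5 <=
    \sum_(v in K | ~~ c v) (deg e v + o v + 4 * (deg e v <= 2)).
  apply: leq_sum => v /andP[vK cv]; have := degK v vK; have := maxc v cv.
  by rewrite -/(o v); case: (deg e v) => [|[|[|[|[|d]]]]] //=; lia.
have double_count : \sum_(v in K | ~~ c v) o v = \sum_(w in K | c w) o' w.
  under eq_bigr do rewrite /o -sum1dep_card.
  under [RHS]eq_bigr do rewrite /o' -sum1dep_card.
  rewrite (exchange_big_dep (fun w => (w \in K) && c w)) /=; last first.
    by move=> v w /andP[vK _] /andP[evw ->]; rewrite -(clK _ _ evw) vK.
  apply: eq_bigr => w /andP[wK cw]; apply: eq_bigl => v.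
  rewrite cw andbT sym_e; case: (boolP (e w v)) => [ewv|]; last by rewrite !andbF.
  by rewrite -(clK _ _ ewv) wK andbT.
(* A star with [l] leaves needs 5 (l + 1). Its center has at least [l] covered neighbors and each
   leaf at least one, so 2 l + 17 is available, which is enough because [l <= 4]. *)
have covered : \sum_(w in K | c w) 5 <=
    \sum_(w in K | c w) o w + 17 * #|[set s in K | c s == Some s]|.
  (* The default [w] is taken only at uncovered vertices, which the sums below exclude. *)
  pose ctr w := odflt w (c w).
  have toK w : (w \in K) && c w -> (ctr w \in K) && (c (ctr w) == Some (ctr w)).
    case/andP=> wK; rewrite /ctr; case cw : (c w) => [s|//] _ /=.
    have [-> /orP[/eqP<-|esw] _ _] := star_packingP pc cw; rewrite eqxx andbT //.
    by rewrite (clK _ _ esw).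
  have split_stars (F : T -> nat) : \sum_(w in K | c w) F w =
      \sum_(s | (s \in K) && (c s == Some s))
        \sum_(w | (w \in K) && c w && (ctr w == s)) F w.
    exact: partition_big.
  rewrite !split_stars mulnC -sum1_card big_distrl /=.
  rewrite [X in _ + X](eq_bigl (fun s => (s \in K) && (c s == Some s))); last first.
    by move=> s; rewrite inE.
  rewrite -big_split /=; apply: leq_sum => s /andP[sK /eqP cs].
  have starE w : ((w \in K) && c w && (ctr w == s)) = (c w == Some s).
    rewrite /ctr; case cw : (c w) => [t|] /=; last by rewrite andbF.
    rewrite andbT; apply/andP/eqP=> [[_ /eqP->] //|[Et]]; rewrite Et eqxx; split=> //.
    rewrite Et in cw; have [_ /orP[/eqP->|esw] _ _] // := star_packingP pc cw.
    by rewrite -(clK _ _ esw).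
  rewrite !(eq_bigl _ _ starE).
  have [_ _ /andP[_ ds] _] := star_packingP pc cs.
  rewrite !(bigD1 s (P := fun w => c w == Some s)) /= ?cs //.
  set l := #|[set w | (c w == Some s) && (w != s)]|.
  have leaf w : (c w == Some s) && (w != s) -> e s w.
    by case/andP=> /eqP/(star_packingP pc)[_ /orP[->|]].
  have l_le : l <= o s.
    apply/subset_leq_card/subsetP=> w; rewrite !inE => Hw; rewrite leaf //=.
    by case/andP: Hw => /eqP->.
  have l4 : l <= 4.
    rewrite -ltnS (leq_trans _ ds) // ltnS.
    by apply/subset_leq_card/subsetP=> w; rewrite !inE; apply: leaf.
  have leaves : l <= \sum_(w | (c w == Some s) && (w != s)) o w.
    rewrite /l -sum1dep_card; apply: leq_sum => w Hw.
    by apply/card_gt0P; exists s; rewrite inE sym_e leaf //= cs.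
  have -> : \sum_(w | (c w == Some s) && (w != s)) 5 = l * 5.
    by rewrite sum_nat_cond_const.
  move: leaves; set L := \sum_(w | _) _; lia.
have zE : \sum_(v in K | ~~ c v) (4 * (deg e v <= 2)) <=
    4 * #|[set x in K | deg e x <= 2]|.
  rewrite card_setI_sum big_distrr /=.
  by rewrite [X in _ <= X](bigID (fun v => c v : bool)) /= leq_addl.
have -> : 5 * #|K| = \sum_(w in K | c w) 5 + \sum_(v in K | ~~ c v) 5.
  by rewrite -(bigID (fun v => c v : bool)) /= sum_nat_const mulnC.
have -> : \sum_(x in K) deg e x = \sum_(w in K | c w) o w
    + \sum_(w in K | c w) o' w + \sum_(v in K | ~~ c v) deg e v.
  rewrite (bigID (fun v => c v : bool)) /= -big_split /=; congr (_ + _).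
  by apply: eq_bigr => w _.
rewrite 2!big_split /= double_count in uncovered.
lia.
Qed.

End Stars.

(** * The coloring and the final count *)

Lemma deg_blue (T : finType) (e red : rel T) x : subrel red e ->
  deg e x = deg red x + deg (blue_of e red) x.
Proof.
move=> red_e; rewrite (deg_split e (red x)); congr (_ + _); apply: eq_card => y;
  rewrite !inE // andbC.
by case: (boolP (red x y)) => // /red_e ->.
Qed.

Lemma connect_deg_gt0 (T : finType) (r : rel T) x y :
  x != y -> connect r x y -> 0 < deg r x.
Proof.
move=> + /connectP[[|z p] /= ]; first by move=> /[swap] _ /[swap] ->; rewrite eqxx.
by move=> _ /andP[rxz _] _; apply/card_gt0P; exists z; rewrite inE.
Qed.

Lemma coloring_path_edges (T : finType) (e : rel T) : simple_graph e ->
  exists2 red : rel T, red_coloring e red /\ acyclic red &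
    forall n, 2 <= n -> contains_path (blue_of e red) n ->
      58 * n <= 28 * num_edges e + 140.
Proof.
move=> [sym_e irr_e]; have [c pc maxc] := maximal_star_packing irr_e.
have [red [sym_red red_e star_red ac_red con_red]] := spanning_forest sym_e
  (@star_edge_sym _ c) (star_edge_sub sym_e pc) (star_edge_acyclic pc).
exists red; first by [].
move=> n n2 [[|x0 q] /and3P[/eqP sz uq pq]]; first by move: n2; rewrite -sz.
pose b := blue_of e red.
have sym_b : symmetric b by move=> x y; rewrite /b /blue_of sym_e sym_red.
(* By [con_red] this red component is also the component of [x0] in [e], so it contains the blue
   path. *)
pose K := [set x | connect red x0 x].
have conK x : (x \in K) = connect red x0 x by rewrite inE.
have clK x y : e x y -> (x \in K) = (y \in K).
  move/con_red => cxy; rewrite !conK.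
  by apply/idP/idP=> /connect_trans->; rewrite // (sym_connect_sym sym_red).
have pathK x : x \in x0 :: q -> x \in K.
  move=> xq; rewrite conK.
  have : connect b x0 x by apply: (path_connect pq).
  by apply: connect_sub => u v /andP[/con_red].
have degK x : x \in K -> 0 < deg red x.
  rewrite conK => cx; case: (eqVneq x x0) => [->|nx].
    case: q sz uq pathK {pq} => [|z q] sz; first by move: n2; rewrite -sz.
    rewrite /= inE negb_or -andbA => /and3P[nz _ _] pathK.
    by apply: connect_deg_gt0 nz _; rewrite -conK pathK // !inE eqxx orbT.
  by apply: connect_deg_gt0 nx _; rewrite (sym_connect_sym sym_red).
pose y := #|[set x in K | 1 < deg b x]|.
have y_ge : n <= y + 2.
  suff : size (behead (belast x0 q)) <= y.
    by rewrite size_behead size_belast -sz /=; lia.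
  have u' : uniq (behead (belast x0 q)).
    move: uq; rewrite lastI rcons_uniq => /andP[_].
    by case: (belast x0 q) => //= ? ? /andP[].
  rewrite -(card_uniqP u'); apply/subset_leq_card/subsetP=> x xI.
  rewrite inE (path_interior_deg sym_b uq pq xI) andbT pathK //.
  by apply/mem_belast/mem_behead.
have deg_e x := deg_blue x red_e; rewrite -/b in deg_e.
have D_le : \sum_(x in K) deg e x <= 2 * num_edges e.
  rewrite (leq_trans _ (handshake_le irr_e)) //.
  by rewrite [X in _ <= X](bigID (fun x => x \in K)) /= leq_addr.
have red_ge := deg_sum_connected sym_red conK.
have blue_ge : 2 * y <= \sum_(x in K) deg b x.
  rewrite /y card_setI_sum big_distrr /=; apply: leq_sum => x _.
  by case: ltnP; rewrite ?muln0 ?muln1.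
have degE : \sum_(x in K) deg e x = \sum_(x in K) deg red x + \sum_(x in K) deg b x.
  by rewrite -big_split; apply: eq_bigr => x _; apply: deg_e.
(* The three sets are disjoint: centers have degree at least 3 and all but at most one of their
   edges red, while a vertex of degree at most 2 has a red edge by [degK]. *)
have count : #|[set s in K | c s == Some s]| + #|[set x in K | deg e x <= 2]| + y
    <= #|K|.
  rewrite /y !card_setI_sum -!big_split -sum1_card /=; apply: leq_sum => x xK.
  have := degK x xK; have := deg_e x.
  case: eqP => [cx|_] /=; last by case: leqP; case: ltnP => //=; lia.
  have [_ _ /andP[d2 _] _] := star_packingP pc cx.
  have := star_edge_deg pc cx.
  have : deg (star_edge c) x <= deg red x.
    by apply/subset_leq_card/subsetP=> z; rewrite !inE; apply: star_red.
  by case: leqP; case: ltnP => //=; lia.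
have degKe x : x \in K -> 0 < deg e x.
  by move/degK => /leq_trans->; rewrite // deg_e leq_addr.
(* With k and D as in the overview, 5 k <= D + 17 (k - y) and 2 k <= D + 2 - 2 y give 29 y <= 7 D +
   12. Doubling and using [n <= y + 2] turns 24 into 24 + 116 = 140. *)
have := star_packing_card sym_e pc maxc clK degKe; clearbody y K; lia.
Qed.

Local Open Scope ring_scope.

Theorem theorem1p4 :
  exists C : rat, exists N : nat, forall n : nat, (N <= n)%N ->
    forall (T : finType) (e : rel T), simple_graph e ->
      (num_edges e)%:R <= (2 + 43%:R / 651%:R) * n%:R - C ->
      exists red : rel T,
        red_coloring e red /\ acyclic red /\ ~ contains_path (blue_of e red) n.
Proof.
(* A blue path would force at least (29/14) n - 5 edges, since 140 / 28 = 5; any constant above 5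
   gives the contradiction. *)
exists 6%:R, 2 => n n2 T e /coloring_path_edges[red [colr acr] few] le_m.
exists red; split=> //; split=> // /(few n n2).
rewrite -(ler_nat rat) natrD !natrM => le_n.
have n0 : 0 <= n%:R :> rat by [].
lra.
Qed.
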